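(* Every finite-dimensional Banach space $E$ is USD-nonfriendly.
   Context: Banach spaces are real. $B(E)$ is the closed unit ball and $S(E)$ the unit sphere of a Banach space $E$. For $x,y\in E$ and $\varepsilon>0$ put $D(x,y,\varepsilon)=\{z\in E:\|x+y+z\|>2-\varepsilon,\ \|y+z\|<1+\varepsilon\}$ and $\mathcal{D}(E)=\{D(x,y,\varepsilon): x,y\in S(E),\ \varepsilon>0\}$. A Banach space $E$ is USD-nonfriendly if there exists $\alpha>0$ such that every closed absolutely convex (i.e. nonempty, convex and balanced) subset $A\subset E$ which intersects every element of $\mathcal{D}(E)$ contains $\alpha B(E)$. *)

(* Defs.v *)
From HB Require Import structures.
From mathcomp Require Import all_boot all_order all_algebra.
From mathcomp Require Import all_classical all_reals all_analysis.
Set Implicit Arguments.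
Unset Strict Implicit.
Unset Printing Implicit Defensive.
Import Order.TTheory GRing.Theory Num.Theory.
Import numFieldNormedType.Exports.
Local Open Scope classical_set_scope.
Local Open Scope ring_scope.

Section usd_nonfriendly.
Context {R : realType}.

(* Vector.axiom n E is the type of linear bijections E -> 'rV[R]_n, the data
   behind a vectType structure; n = 0 (the zero space) is allowed. *)
Definition finite_dimensional (E : lmodType R) : Prop :=
  exists n : nat, inhabited (Vector.axiom n E).

Definition unit_ball (E : normedModType R) : set E := [set x | `|x| <= 1].

Definition unit_sphere (E : normedModType R) : set E := [set x | `|x| = 1].

Definition balanced_set (E : lmodType R) (A : set E) : Prop :=
  forall (c : R) (x : E), `|c| <= 1 -> A x -> A (c *: x).

Definition absolutely_convex (E : lmodType R) (A : set E) : Prop :=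
  [/\ A !=set0, convex_set A & balanced_set A].

Definition D_set (E : normedModType R) (x y : E) (eps : R) : set E :=
  [set z | 2 - eps < `|x + y + z| /\ `|y + z| < 1 + eps].

Definition D_family (E : normedModType R) : set (set E) :=
  [set U | exists x y eps, [/\ unit_sphere x, unit_sphere y, 0 < eps
                             & U = D_set x y eps]].

Definition USD_nonfriendly (E : completeNormedModType R) : Prop :=
  exists2 alpha : R, 0 < alpha &
    forall A : set E, closed A -> absolutely_convex A ->
      (forall U, @D_family E U -> A `&` U !=set0) ->
      [set alpha *: x | x in @unit_ball E] `<=` A.

End usd_nonfriendly.

(* Main.v *)
(* Suppose A misses a point of norm at most al. A Riesz-type argument gives a
   unit vector y at distance at least 1 - 2 al from A, so with e = 2 al every
   mean of vectors y + z_i, with z_i in A and |y + z_i| < 1 + e, has norm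
   within e of 1. Given z_1, ..., z_m in A with mean a, put w = y + a and
   x = - w / |w|; any z in A meeting D(x, y, e) is at distance at least 2 - 2 e
   from a. As |z - z_i| <= 2 + 2 e for all i, no |z - z_i| can be smaller than 1
   when 4 m e <= 1. Iterating gives more 1-separated points in a ball of radius
   3 than compactness allows, unless al is bounded below. *)

Require Import Defs.
From HB Require Import structures.
From mathcomp Require Import all_boot all_order all_algebra.
From mathcomp Require Import all_classical all_reals all_analysis.
From mathcomp Require Import finmap lra ring.
Set Implicit Arguments.
Unset Strict Implicit.
Unset Printing Implicit Defensive.
Import Order.TTheory GRing.Theory Num.Theory.
Import numFieldNormedType.Exports.
Local Open Scope classical_set_scope.
Local Open Scope ring_scope.

Lemma convex_setP (R : realType) (E : lmodType R) (A : set E) :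
  convex_set A -> forall (t : R) (x y : E), 0 <= t -> t <= 1 ->
  A x -> A y -> A (t *: x + (1 - t) *: y).
Proof.
move=> cA t x y t0 t1 Ax Ay.
exact: set_mem (cA x y (Itv01 t0 t1) (mem_set Ax) (mem_set Ay)).
Qed.

Lemma convex_mean (R : realType) (E : lmodType R) (A : set E) (s : seq E) :
  convex_set A -> (forall z, z \in s -> A z) -> (0 < size s)%N ->
  A ((size s)%:R^-1 *: \sum_(z <- s) z).
Proof.
move=> cA; elim: s => // x s IHs sA _; rewrite big_cons.
have Ax : A x by apply: sA; rewrite mem_head.
(* The head gets weight 1 / (m + 1) and the mean of the m tail points the rest; an empty tail has no
   mean for the induction and is treated apart. *)
have [/size0nil s0|s_gt0] := posnP (size s); last first.
  have m0 : 0 < (size s)%:R :> R by rewrite ltr0n.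
  rewrite [size (x :: s)]/= -natr1.
  have -> : ((size s)%:R + 1)^-1 *: (x + \sum_(z <- s) z) =
      ((size s)%:R + 1)^-1 *: x +
      (1 - ((size s)%:R + 1)^-1) *: ((size s)%:R^-1 *: \sum_(z <- s) z).
    rewrite scalerDr scalerA; congr (_ + _ *: _); field.
    by rewrite !lt0r_neq0//; lra.
  apply: (convex_setP cA) => //.
  - by rewrite invf_le1; lra.
  - by apply: IHs => // z zs; apply: sA; rewrite in_cons zs orbT.
rewrite s0 /=.
by rewrite big_nil addr0 invr1 scale1r.
Qed.

Lemma closed_dist_bounded_below (R : realType) (E : normedModType R) (A : set E)
    (q : E) : closed A -> ~ A q ->
  exists2 e : R, 0 < e & forall a, A a -> e <= `|q - a|.
Proof.
move=> clA nAq.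
have /nbhs_ballP[e /= e0 He] : nbhs q (~` A).
  by apply: open_nbhs_nbhs; split => //; exact: closed_openC.
exists e => // a Aa; rewrite leNgt; apply/negP => qa.
by apply: (He a) Aa; rewrite -ball_normE.
Qed.

Lemma exists_far_unit_vector (R : realType) (E : normedModType R) (A : set E)
    (al : R) (q0 : E) :
  closed A -> convex_set A -> A 0 -> al < 2^-1 -> `|q0| <= al -> ~ A q0 ->
  exists2 y : E, `|y| = 1 & forall a, A a -> 1 - 2 * al <= `|y - a|.
Proof.
move=> clA cA A0 al2 q0al nAq0.
have [e e0 He] := closed_dist_bounded_below clA nAq0.
(* Fattening A by e makes every q outside B have norm at least e. Take such a q
   of almost minimal norm and y = q / |q|: if |y - a| < 1 - 2 al, then q is a
   convex combination of a and a vector b too short to be outside B, so q is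
   in B. *)
pose B := [set x : E | exists2 a, A a & `|x - a| < e].
have ABconv a b t : A a -> B b -> 0 <= t -> t <= 1 ->
    B (t *: a + (1 - t) *: b).
  move=> Aa [a' Aa' ba'] t0 t1.
  exists (t *: a + (1 - t) *: a'); first exact: (convex_setP cA).
  rewrite opprD addrACA subrr add0r -scalerBr normrZ ger0_norm; last lra.
  by rewrite (le_lt_trans _ ba')// ler_piMl//; lra.
pose N := [set r : R | exists2 q, ~ B q & `|q| = r].
have Nlb : lbound N e.
  move=> _ [q nBq <-]; rewrite leNgt; apply/negP => qe; apply: nBq.
  by exists 0 => //; rewrite subr0.
have hlN : has_lbound N by exists e.
have Nq0 : N `|q0|.
  exists q0 => // -[a Aa]; apply/negP; rewrite -leNgt; exact: He.
have er : e <= inf N by apply: lb_le_inf => //; exists `|q0|.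
have ral : inf N <= al by apply: le_trans q0al; exact: ge_inf.
(* The slack is relative to r = [inf N]. As r <= al, a q with |q| < r (1 + al) satisfies |q| (1 - 2
   al) < r (1 - al - 2 al^2) <= r (1 - |q|), which makes the later b shorter than r. *)
have ral0 : 0 < inf N * al by rewrite mulr_gt0//; lra.
have infN : has_inf N by split => //; exists `|q0|.
have [_ [q nBq <-] qr] := inf_adherent ral0 infN.
set r := inf N in er ral ral0 qr.
have rq : r <= `|q| by apply: ge_inf => //; exists q.
have q_gt0 : 0 < `|q| by lra.
have q1 : `|q| < 1 by nra.
exists (`|q|^-1 *: q) => [|a Aa].
  by rewrite normrZ normrV ?unitfE ?gt_eqF// normr_id mulVf// gt_eqF.
rewrite leNgt; apply/negP => ya; apply: nBq.
set y := _ *: q in ya.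
have qy : q = `|q| *: y by rewrite scalerA divff ?scale1r// gt_eqF.
pose b := (1 - `|q|)^-1 *: (`|q| *: (y - a)).
have -> : q = `|q| *: a + (1 - `|q|) *: b.
  rewrite /b scalerA divff ?scale1r; last by rewrite gt_eqF//; lra.
  by rewrite scalerBr -qy addrC subrK.
apply: ABconv => //; last lra.
apply: contrapT => nBb.
have : r <= `|b| by apply: ge_inf => //; exists b.
rewrite /b !normrZ normr_id gtr0_norm ?invr_gt0; last lra.
rewrite mulrC ler_pdivlMr; last lra.
apply/negP; rewrite -ltNge.
have : `|q| * `|y - a| <= `|q| * (1 - 2 * al) by rewrite ler_pM2l// ltW.
nra.
Qed.

(** A ball of radius 1/2 holds at most one point of a 1-separated family, so the size of a finite
    cover by such balls serves as N. *)
Lemma compact_separated_bound (R : realType) (E : normedModType R)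
    (K : set E) : compact K ->
  exists N : nat, forall s : seq E, (forall z, z \in s -> K z) ->
    pairwise (fun x y => 1 <= `|x - y|) s -> (size s <= N)%N.
Proof.
rewrite compact_cover => cK.
have [||D _ KD] := cK E setT (fun x => ball x (2^-1 : R)).
- by move=> x _; apply: ball_open.
- by move=> x _; exists x => //; exact: ballxx.
(* [c] picks the centre of a covering ball, with junk value 0 off K; separation makes it injective
   on [s]. *)
have /choice[c Hc] : forall z, exists x : E,
    K z -> x \in D /\ `|x - z| < 2^-1 :> R.
  move=> z; have [/KD[x /= xD]|nKz] := pselect (K z); last by exists 0.
  by rewrite -ball_normE => xz; exists x.
exists #|` D| => s sK sep; rewrite -(size_map c); apply: uniq_leq_size.
  rewrite uniq_pairwise pairwise_map.
  apply: (sub_in_pairwise (P := mem s)) sep => //.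
  move=> x y xs ys /=; apply: contraTneq => cxy.
  have [_ cx] := Hc x (sK _ xs); have [_ cy] := Hc y (sK _ ys).
  rewrite -ltNge (le_lt_trans (ler_distD (c x) _ _))//.
  by rewrite distrC {2}cxy; lra.
by move=> _ /mapP[z zs ->]; have [] := Hc z (sK _ zs).
Qed.

(** The coordinate map g from R^n is continuous and, by compactness of the unit sphere of R^n,
    bounded below: c |v| <= |g v|. The ball is thus the continuous image of a closed bounded set of
    coordinates. *)
Lemma finite_dimensional_compact_ball (R : realType) (E : normedModType R)
    (r : R) : finite_dimensional E -> compact [set x : E | `|x| <= r].
Proof.
move=> [n [[f linf [g fK gK]]]].
have gL : linear g by move=> a u v; apply: (can_inj fK); rewrite linf !gK.
pose G : {linear 'rV[R]_n -> E} :=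
  HB.pack g (GRing.isLinear.Build _ _ _ _ g gL).
have gZ a v : g (a *: v) = a *: g v by exact: (linearZ_LR G).
have gE v : g v = \sum_(i < n) v 0 i *: g (delta_mx 0 i).
  rewrite -[v in LHS](mulmx1 v) mulmx_sum_row.
  have -> : g = G by [].
  rewrite linear_sum; apply: eq_bigr => i _.
  by rewrite row1 [LHS]gZ.
have gcont : continuous g.
  rewrite (_ : g = fun v => \sum_(i < n) v 0 i *: g (delta_mx 0 i)); last first.
    by apply/funext.
  apply: continuous_big => [|i _]; first exact: add_continuous.
  by move=> v; apply: (cvgZ (F := nbhs v));
    [exact: coord_continuous|exact: cvg_cst].
pose S := [set v : 'rV[R]_n | `|v| = 1].
have Scompact : compact S.
  apply: bounded_closed_compact.
    by exists 1; split => // M M1 v /= ->; exact: ltW.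
  apply: (@closed_comp _ _ (fun v : 'rV[R]_n => `|v|) [set 1]) => //.
    by move=> v _; exact: norm_continuous.
have [c c0 cg] : exists2 c : R, 0 < c & forall v, S v -> c <= `|g v|.
  (* For n = 0 the sphere is empty and c = 1 will do; otherwise |g v| attains its minimum on S,
     which is nonzero because g is injective. *)
  have [S0|/set0P/negP] := pselect (S !=set0); last first.
    by rewrite negbK => /eqP ->; exists 1.
  have [|v /set_mem/= Sv vmin] :=
    @compact_EVT_min _ R (fun v => `|g v|) S S0 Scompact.
    apply: continuous_subspaceT => v; apply: (@continuous_comp _ _ _ g).
      exact: gcont.
    exact: norm_continuous.
  exists `|g v|; last by move=> w Sw; apply: vmin; exact: mem_set.
  rewrite normr_gt0; apply/eqP => gv0.
  have v0 : v = 0 by apply: (can_inj gK); rewrite gv0; exact/esym/(linear0 G).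
  move: Sv; rewrite v0 /S/= normr0 => /eqP.
  by rewrite eq_sym oner_eq0.
have gbound v : c * `|v| <= `|g v|.
  have [->|v0] := eqVneq v 0; first by rewrite normr0 mulr0.
  have nv : 0 < `|v| by rewrite normr_gt0.
  have : c <= `|g (`|v|^-1 *: v)|.
    by apply: cg; rewrite /S/= normrZ normfV normr_id mulVf// gt_eqF.
  by rewrite gZ normrZ normfV normr_id mulrC ler_pdivlMr.
pose K := [set v : 'rV[R]_n | `|g v| <= r].
have -> : [set x : E | `|x| <= r] = g @` K.
  apply/seteqP; split => [x xr|_ [v vr <-]]//.
  by exists (f x); rewrite /K/= fK.
apply: continuous_compact; first exact: continuous_subspaceT.
apply: bounded_closed_compact.
  exists (r / c); split => [|M rM v vr]; first exact: num_real.
  rewrite /= (le_trans _ (ltW rM))// ler_pdivlMr// mulrC.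
  exact: le_trans (gbound v) vr.
apply: (@closed_comp _ _ (fun v => `|g v|) [set x | x <= r]) => //.
  move=> v _; apply: (@continuous_comp _ _ _ g); first exact: gcont.
  exact: norm_continuous.
Qed.

(** With m the size of [s], the m distances |z - u| add up to at least m (2 - 2e) and each is at
    most 2 + 2e. Hence any one of them is at least m (2 - 2e) - (m - 1) (2 + 2e) = 2 + 2e - 4me >=
    1. *)
Lemma separated_of_far_mean (R : realFieldType) (E : normedModType R)
    (s : seq E) (y z : E) (e : R) :
  0 < e -> 4 * (size s)%:R * e <= 1 ->
  (forall x, x \in s -> `|y + x| < 1 + e) -> `|y + z| < 1 + e ->
  2 - 2 * e <= `|z - (size s)%:R^-1 *: \sum_(x <- s) x| ->
  forall x, x \in s -> 1 <= `|z - x|.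
Proof.
move=> e0 se sy zy far x xs.
have m0 : 0 < (size s)%:R :> R by rewrite ltr0n; case: s xs {far sy se}.
have up u : u \in s -> `|z - u| <= 2 + 2 * e.
  move=> /sy uy; have -> : z - u = (y + z) - (y + u).
    by rewrite opprD addrACA subrr add0r.
  by rewrite (le_trans (ler_normB _ _))//; lra.
have sumE : (size s)%:R *: (z - (size s)%:R^-1 *: \sum_(x <- s) x) =
    \sum_(u <- s) (z - u).
  rewrite scalerBr scalerA divff ?gt_eqF// scale1r sumrB.
  by rewrite big_const_seq count_predT iter_addr_0 scaler_nat.
have : (size s)%:R * (2 - 2 * e) <= \sum_(u <- s) `|z - u|.
  rewrite (le_trans _ (ler_norm_sum _ _ _))// -sumE normrZ gtr0_norm//.
  by rewrite ler_pM2l.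
rewrite (big_rem x)//=.
have : \sum_(u <- rem x s) `|z - u| <= ((size s)%:R - 1) * (2 + 2 * e).
  have -> : (size s)%:R - 1 = (size (rem x s))%:R :> R.
    by rewrite size_rem// -subn1 natrB// -(ltr0n R).
  have -> : (size (rem x s))%:R * (2 + 2 * e) = \sum_(u <- rem x s) (2 + 2 * e).
    by rewrite big_const_seq count_predT iter_addr_0 mulr_natl.
  rewrite big_seq [leRHS]big_seq; apply: ler_sum => u us.
  by apply: up; exact: mem_rem us.
nra.
Qed.

Lemma separated_extension (R : realType) (E : normedModType R) (A : set E)
    (y : E) (e : R) (s : seq E) :
  convex_set A -> (forall U, D_family U -> A `&` U !=set0) ->
  `|y| = 1 -> (forall a, A a -> 1 - e <= `|y + a|) -> 0 < e -> e < 1 ->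
  4 * (size s)%:R * e <= 1 -> (0 < size s)%N ->
  (forall x, x \in s -> A x /\ `|y + x| < 1 + e) ->
  exists z, [/\ A z, `|y + z| < 1 + e & forall x, x \in s -> 1 <= `|z - x|].
Proof.
move=> cA AD y1 yA e0 e1 se s0 sA.
set a := (size s)%:R^-1 *: \sum_(x <- s) x.
have m0 : 0 < (size s)%:R :> R by rewrite ltr0n.
have Aa : A a by apply: convex_mean => // z /sA[].
have wlo := yA _ Aa.
have whi : `|y + a| <= 1 + e.
  (* The upper bound passes to the mean because this ball around -y is convex. *)
  pose C := [set x : E | `|y + x| <= 1 + e].
  suff : C a by [].
  apply: convex_mean => // [u v t|z /sA[_ /ltW]//].
  move=> /set_mem uC /set_mem vC; apply/mem_set; rewrite /C/= in uC vC *.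
  have -> : y + conv t (u : convex_lmodType E) v =
      t%:num *: (y + u) + (1 - t%:num) *: (y + v).
    by rewrite !scalerDr addrACA -scalerDl subrKC scale1r.
  rewrite (le_trans (ler_normD _ _))// !normrZ.
  rewrite ger0_norm// ger0_norm ?subr_ge0//.
  have : t%:num * `|y + u| <= t%:num * (1 + e) by rewrite ler_wpM2l.
  have : (1 - t%:num) * `|y + v| <= (1 - t%:num) * (1 + e).
    by rewrite ler_wpM2l// subr_ge0.
  nra.
set w := y + a in wlo whi.
have w0 : 0 < `|w| by lra.
(* Opposite to w, which is nonzero since e < 1, this unit vector nearly cancels it: |x + w| = | |w|
   - 1 | <= e. Then x + y + z = (x + w) + (z - a) forces |z - a| > 2 - 2e. *)
pose x := - (`|w|^-1 *: w).
have x1 : `|x| = 1 by rewrite normrN normrZ normfV normr_id mulVf// gt_eqF.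
have [|z [Az [xyz yz]]] := AD (D_set x y e); first by exists x, y, e.
exists z; split => //; apply: (separated_of_far_mean (y := y) (e := e)) => //.
  by move=> u /sA[].
have xw : `|x + w| <= e.
  have -> : x + w = (1 - `|w|^-1) *: w by rewrite scalerBl scale1r addrC.
  rewrite normrZ -[X in _ * X]normr_id -normrM mulrBl mul1r mulVf ?gt_eqF//.
  by rewrite ler_norml; apply/andP; split; lra.
have : `|x + y + z| <= `|x + w| + `|z - a|.
  rewrite (le_trans _ (ler_normD _ _))// /w -(addrA x (y + a)) -(addrA y).
  by rewrite subrKC addrA.
lra.
Qed.

Theorem proposition2p7 (R : realType) (E : completeNormedModType R)
  (finE : finite_dimensional E) : USD_nonfriendly E.
Proof.
(* Radius 3 is enough: |y| = 1 and |y + z| < 1 + e give |z| < 2 + e <= 3. *)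
have [N HN] :=
  compact_separated_bound (finite_dimensional_compact_ball (r := 3) finE).
(* This keeps 4 m e <= 1 for every family size m that gets extended. The radius is then [e / 2], as
   the far unit vector loses twice the radius. *)
pose e : R := (4 * N.+1%:R)^-1.
have N1 : 1 <= N.+1%:R :> R by rewrite ler1n.
have eN : 4 * N.+1%:R * e = 1 by rewrite divff// gt_eqF//; lra.
have e0 : 0 < e by rewrite invr_gt0; lra.
have e1 : e <= 4^-1 by nra.
exists (e / 2) => [|A clA [[a0 Aa0] cA balA] AD _ [p p1 <-]]; first by lra.
have A0 : A 0 by rewrite -(scale0r a0); apply: balA; rewrite ?normr0.
apply: contrapT => nAp.
have [||y y1 yA] := exists_far_unit_vector (al := e / 2) clA cA A0 _ _ nAp.
- lra.
- by rewrite normrZ gtr0_norm ?ler_piMr//; lra.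
have {}yA a : A a -> 1 - e <= `|y + a|.
  move=> Aa; rewrite -[a]opprK (_ : 1 - e = 1 - 2 * (e / 2)); last by lra.
  by apply: yA; rewrite -scaleN1r; apply: balA; rewrite ?normrN1.
(* Starting from the single point 0, index m yields m + 1 points, so m = N already exceeds the
   compactness bound. *)
have sep m : (m <= N)%N -> exists s : seq E, [/\ size s = m.+1,
    forall x, x \in s -> A x /\ `|y + x| < 1 + e &
    pairwise (fun u v => 1 <= `|u - v|) s].
  elim: m => [_|m IHm mN].
    exists [:: 0]; split => // x; rewrite mem_seq1 => /eqP ->.
    by rewrite addr0 y1; split => //; lra.
  have [s [sz sA ss]] := IHm (ltnW mN).
  have [||||z [Az yz zs]] := separated_extension (s := s) cA AD y1 yA e0 => //.
  - lra.
  - have : (m.+1)%:R <= (N.+1)%:R :> R by rewrite ler_nat; exact: ltnW.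
    by rewrite sz; nra.
  - by rewrite sz.
  exists (z :: s); split => [|x|/=]; first by rewrite /= sz.
    by rewrite in_cons => /predU1P[->|/sA].
  by rewrite ss andbT; apply/allP.
have [s [sz sA ss]] := sep N (leqnn N).
suff : (size s <= N)%N by rewrite sz ltnn.
apply: HN => // z /sA[_ yz] /=.
have -> : z = (y + z) - y by rewrite addrC addKr.
by rewrite (le_trans (ler_normB _ _))// y1; lra.
Qed.
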